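(* On the punctured plane $\mathbb{R}^2\setminus\{0\}\cong\mathbb{C}\setminus\{0\}$ with coordinate $q=(x,y)=x+iy$, consider the Riemannian metric $$ds_1^2=\frac{|dq|^2}{4|q|},\qquad |dq|^2=dx^2+dy^2,$$ and give the plane $\mathbb{R}^2$ (the Kepler plane) the distance function induced by $ds_1^2$. A. The Kepler parabolas are (up to reparameterization) geodesics for the metric $ds_1^2$. B. The squaring map $Q\mapsto q=Q^2$, $\mathbb{C}\to\mathbb{C}$, induces an isometry between the Kepler cone and the Kepler plane endowed with the metric $ds_1^2$, namely the map $\{Q,-Q\}\mapsto Q^2$.
   Context: The Kepler cone is the metric quotient $\mathbb{C}/\{\pm1\}$ of the Euclidean plane $\mathbb{C}=\mathbb{R}^2$ by the two-element group acting by $Q\mapsto\pm Q$: its points are the orbits $\{Q,-Q\}$ and the distance between two points of the quotient is the Euclidean distance between the corresponding orbits. The Kepler parabolas are the parabolas in the plane with focus at the origin; they are the curves traced by the zero energy solutions, not lying on rays through the origin, of Kepler's problem $\ddot q=-\mu q/|q|^3$, $\mu>0$, with energy $\frac12|\dot q|^2-\mu/|q|$. *)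

(* Defs.v *)
(* Stdlib reals with Coquelicot: the plane is Coquelicot's C = R * R. *)
From Stdlib Require Import Reals.
From Coquelicot Require Import Coquelicot.
Open Scope R_scope.

(** * Riemannian geometry of plane domains *)

Inductive coord := X | Y.

Definition sum_coord (f : coord -> R) : R := f X + f Y.

Definition proj (k : coord) (q : C) : R :=
  match k with X => fst q | Y => snd q end.

Definition partial (k : coord) (f : C -> R) (q : C) : R :=
  match k with
  | X => Derive (fun x => f (x, snd q)) (fst q)
  | Y => Derive (fun y => f (fst q, y)) (snd q)
  end.

(* The components g_ij; only their values on the domain of the metric matter. *)
Definition metric := coord -> coord -> C -> R.

Definition metric_det (g : metric) (q : C) : R :=
  g X X q * g Y Y q - g X Y q * g Y X q.

Definition metric_inv (g : metric) (i j : coord) (q : C) : R :=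
  match i, j with
  | X, X => g Y Y q / metric_det g q
  | X, Y => - g X Y q / metric_det g q
  | Y, X => - g Y X q / metric_det g q
  | Y, Y => g X X q / metric_det g q
  end.

(* Levi-Civita connection: christoffel g k i j is Gamma^k_ij. *)
Definition christoffel (g : metric) (k i j : coord) (q : C) : R :=
  / 2 * sum_coord (fun l =>
    metric_inv g k l q *
      (partial i (g j l) q + partial j (g i l) q - partial l (g i j) q)).

Definition component (gam : R -> C) (k : coord) (t : R) : R := proj k (gam t).

Definition velocity (gam : R -> C) (k : coord) (t : R) : R :=
  Derive (component gam k) t.

Definition speed (g : metric) (gam : R -> C) (t : R) : R :=
  sqrt (sum_coord (fun i => sum_coord (fun j =>
    g i j (gam t) * velocity gam i t * velocity gam j t))).

Definition C1_at (gam : R -> C) (t : R) : Prop :=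
  forall k, ex_derive (component gam k) t /\ continuous (velocity gam k) t.

(* Affinely parameterized geodesic of (U, g), defined for all times. *)
Definition geodesic (g : metric) (U : C -> Prop) (gam : R -> C) : Prop :=
  forall t, U (gam t) /\
    forall k,
      ex_derive (component gam k) t /\
      ex_derive (velocity gam k) t /\
      Derive (velocity gam k) t +
        sum_coord (fun i => sum_coord (fun j =>
          christoffel g k i j (gam t) * velocity gam i t * velocity gam j t))
      = 0.

Definition regular_parameterization (gam : R -> C) (S : C -> Prop) : Prop :=
  (forall t, C1_at gam t /\ exists k, velocity gam k t <> 0) /\
  (forall s t, gam s = gam t -> s = t) /\
  (forall q, S q <-> exists t, gam t = q).

Definition geodesic_up_to_reparameterization
    (g : metric) (U : C -> Prop) (S : C -> Prop) : Prop :=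
  exists gam, regular_parameterization gam S /\ geodesic g U gam.

(* A continuous arc, C^1 in U except perhaps at its endpoints, of length L.
   The endpoints may lie on the boundary of U, where g can be singular, so
   the length is an improper integral. *)
Definition arc (g : metric) (U : C -> Prop) (gam : R -> C) (a b L : R) : Prop :=
  a < b /\
  continuous_on (fun t => a <= t <= b) gam /\
  (forall t, a < t < b -> U (gam t) /\ C1_at gam t) /\
  is_RInt_gen (speed g gam) (at_right a) (at_left b) L.

(* Lengths of the piecewise C^1 curves from p to q which stay in U except at
   finitely many instants. *)
Inductive joined (g : metric) (U : C -> Prop) : C -> C -> R -> Prop :=
| joined_refl p : joined g U p p 0
| joined_arc gam a b L q L' :
    arc g U gam a b L -> joined g U (gam b) q L' ->
    joined g U (gam a) q (L + L').

(* Also defined for p, q outside U: when U is the plane minus a point, this is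
   the extension of the Riemannian distance to the whole plane. *)
Definition riemannian_dist (g : metric) (U : C -> Prop) (p q : C) : Rbar :=
  Glb_Rbar (joined g U p q).

(** * Euclidean notions *)

Definition set_dist (A B : C -> Prop) : Rbar :=
  Glb_Rbar (fun r => exists P P', A P /\ B P' /\ r = Cmod (P - P')%C).

Definition line (ell : C -> Prop) : Prop :=
  exists P V : C, V <> RtoC 0 /\
    forall q, ell q <-> exists t : R, q = (P + RtoC t * V)%C.

Definition parabola_with_focus (F : C) (S : C -> Prop) : Prop :=
  exists directrix, line directrix /\ ~ directrix F /\
    forall q, S q <-> Finite (Cmod (q - F)%C) = set_dist (eq q) directrix.

(** * The Kepler plane and the Kepler cone *)

Definition punctured_plane (q : C) : Prop := q <> RtoC 0.

Definition ds1 : metric := fun i j q =>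
  match i, j with
  | X, X | Y, Y => / (4 * Cmod q)
  | _, _ => 0
  end.

Definition kepler_plane_dist : C -> C -> Rbar :=
  riemannian_dist ds1 punctured_plane.

Definition kepler_parabola : (C -> Prop) -> Prop :=
  parabola_with_focus (RtoC 0).

Definition orbit (Q : C) : C -> Prop := fun P => P = Q \/ P = Copp Q.

Definition kepler_cone : Type := {A : C -> Prop | exists Q, A = orbit Q}.

Definition cone_point (Q : C) : kepler_cone :=
  exist _ (orbit Q) (ex_intro _ Q eq_refl).

Definition kepler_cone_dist (A B : kepler_cone) : Rbar :=
  set_dist (proj1_sig A) (proj1_sig B).

(* Distances are in Rbar so that equality of distances has no junk value. *)
Definition isometry {M N : Type}
    (dM : M -> M -> Rbar) (dN : N -> N -> Rbar) (f : M -> N) : Prop :=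
  (forall x y, dN (f x) (f y) = dM x y) /\
  (forall x y, f x = f y -> x = y) /\
  (forall z, exists x, f x = z).

(* Main.v *)
Require Import Defs.
From Stdlib Require Import Reals Lra Psatz.
From Stdlib Require Import IndefiniteDescription FunctionalExtensionality.
From Stdlib Require Import PropExtensionality ProofIrrelevance.
From Coquelicot Require Import Coquelicot.

(** Everything follows from one computation: if [q = Q^2] then
    [|dq|^2 / (4 |q|) = |dQ|^2], so the squaring map is a local isometry from the
    punctured Euclidean plane onto the punctured Kepler plane.

    A. A local isometry sends straight lines to geodesics: the square of an affine
    line that avoids the origin satisfies the geodesic equation
    ([squared_line_geodesic]). A parabola with focus at the origin is such a
    square. If its vertex is [w^2], then its directrix is the set of the
    [2 w^2 (1 + i t)], the defining equation reads [|z| = |Re z - 2|] in terms of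
    [z = q / w^2], and its solutions are the [z = (1 + i t)^2]
    ([kepler_parabola_squared_line]). So the parabola is the square of the line
    [w (1 + i t)].

    B. The distance in the cone between the orbits of [P] and [Q] is the smaller of
    [|P - Q|] and [|P + Q|], called [cone_gap P Q] below. It has to be shown that
    this is the distance from [P^2] to [Q^2] in the Kepler plane.

    It is an upper bound: replace [Q] by [- Q] if necessary, so that
    [|P - Q| <= |P + Q|]. Then the segment from [P] to [Q] meets the origin
    at most at its ends, and its square is an arc of length [|P - Q|]
    ([joined_segment]).

    It is a lower bound: a curve need not be lifted continuously through the
    squaring map. The function [cone_gap] is already a distance between squares, and
    along a curve [gam] its growth rate at a point off the origin is at most the
    speed. Indeed [(P - Q) (P + Q) = P^2 - Q^2], and [|P + Q|] is close to
    [2 |P|] when [|P - Q|] is small ([cone_gap_near], [lift_increment_le]).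
    Together with the triangle inequality, this local bound gives the global bound
    by the integral of the speed ([subadditive_local_to_global],
    [cone_gap_le_length]). At the ends of an arc, where the curve may touch the
    origin, the inequality [cone_gap P Q ^ 2 <= |P^2 - Q^2|] and continuity
    suffice ([cone_gap_le_arc]). *)

(** * Moduli and square roots of complex numbers *)

Lemma Cmod_sqr (q : C) : Cmod q * Cmod q = fst q * fst q + snd q * snd q.
Proof. unfold Cmod. rewrite sqrt_sqrt; nra. Qed.

Lemma Cmod_square (Q : C) : Cmod (Q ^ 2)%C = Cmod Q * Cmod Q.
Proof. rewrite Cmod_pow. ring. Qed.

Lemma le_Cmod (q : C) (m : R) :
  0 <= m -> fst q * fst q + snd q * snd q <= m * m -> Cmod q <= m.
Proof. intros Hm H. rewrite <- Cmod_sqr in H. pose proof (Cmod_ge_0 q). nra. Qed.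

Lemma Cmod_unique (q : C) (m : R) :
  0 <= m -> m * m = fst q * fst q + snd q * snd q -> Cmod q = m.
Proof. intros Hm H. rewrite <- Cmod_sqr in H. pose proof (Cmod_ge_0 q). nra. Qed.

(** The half-angle formulas: the root has coordinates
    [sqrt ((|q| + x) / 2)] and [+/- sqrt ((|q| - x) / 2)]. *)
Lemma C_square_root (q : C) : exists Q : C, (Q ^ 2)%C = q.
Proof.
  destruct q as [x y].
  pose proof (Cmod_ge_0 (x, y)) as Hr. pose proof (Cmod_sqr (x, y)) as Hm.
  simpl in Hm. set (r := Cmod (x, y)) in *.
  assert (Hx : -r <= x <= r) by nra.
  set (a := sqrt ((r + x) / 2)). set (b := sqrt ((r - x) / 2)).
  assert (Ha : a * a = (r + x) / 2) by (apply sqrt_sqrt; lra).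
  assert (Hb : b * b = (r - x) / 2) by (apply sqrt_sqrt; lra).
  assert (Ha0 : 0 <= a) by apply sqrt_pos.
  assert (Hb0 : 0 <= b) by apply sqrt_pos.
  assert (Hab : (2 * (a * b)) * (2 * (a * b)) = y * y).
  { replace (2 * (a * b) * (2 * (a * b))) with (4 * (a * a) * (b * b)) by ring.
    rewrite Ha, Hb. lra. }
  assert (Hab0 : 0 <= a * b) by (apply Rmult_le_pos; assumption).
  destruct (Rle_dec 0 y).
  - assert (2 * (a * b) = y) by nra.
    exists (a, b). apply injective_projections; simpl; nra.
  - assert (2 * (a * b) = - y) by nra.
    exists (a, - b). apply injective_projections; simpl; nra.
Qed.

Lemma C_square_eq (P Q : C) : (P ^ 2 = Q ^ 2)%C -> P = Q \/ P = (- Q)%C.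
Proof.
  intros H.
  assert (H0 : ((P - Q) * (P + Q) = 0)%C).
  { replace ((P - Q) * (P + Q))%C with (P ^ 2 - Q ^ 2)%C by ring.
    rewrite H. ring. }
  assert (H1 : Cmod (P - Q)%C * Cmod (P + Q)%C = 0).
  { rewrite <- Cmod_mult, H0. apply Cmod_0. }
  apply Rmult_integral in H1. destruct H1 as [H1|H1]; apply Cmod_eq_0 in H1.
  - left. rewrite <- (Cplus_0_r Q), <- H1. ring.
  - right. rewrite <- (Cplus_0_r (- Q)%C), <- H1. ring.
Qed.

(** * Squares of straight lines are geodesics *)

Definition affine (P V : C) (t : R) : C := (P + RtoC t * V)%C.
Definition squared_line (P V : C) (t : R) : C := (affine P V t ^ 2)%C.

Lemma is_derive_squared_line (P V : C) (k : coord) (t : R) :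
  is_derive (component (squared_line P V) k) t (proj k (2 * (V * affine P V t))%C).
Proof.
  destruct P as [a b], V as [c d]; destruct k; unfold component, squared_line, affine; simpl;
    auto_derive; trivial; ring.
Qed.

Lemma velocity_squared_line (P V : C) (k : coord) (t : R) :
  velocity (squared_line P V) k t = proj k (2 * (V * affine P V t))%C.
Proof. apply is_derive_unique, is_derive_squared_line. Qed.

Lemma is_derive_velocity_squared_line (P V : C) (k : coord) (t : R) :
  is_derive (velocity (squared_line P V) k) t (proj k (2 * V ^ 2)%C).
Proof.
  apply (is_derive_ext (fun s => proj k (2 * (V * affine P V s))%C)).
  - intros s. symmetry. apply velocity_squared_line.
  - destruct P as [a b], V as [c d]; destruct k; unfold affine; simpl;
      auto_derive; trivial; ring.
Qed.

Lemma C1_squared_line (P V : C) (t : R) : C1_at (squared_line P V) t.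
Proof.
  intros k. split.
  - eexists. apply is_derive_squared_line.
  - apply (@ex_derive_continuous R_AbsRing R_NormedModule).
    eexists. apply is_derive_velocity_squared_line.
Qed.

Lemma sum_sqr_gt_0 (q : C) : q <> 0%C -> 0 < fst q * fst q + snd q * snd q.
Proof. intros H. apply Cmod_gt_0 in H. rewrite <- Cmod_sqr. nra. Qed.

Lemma is_derive_inv_4_sqrt (f : R -> R) (t df : R) :
  is_derive f t df -> 0 < f t ->
  is_derive (fun s => / (4 * sqrt (f s))) t
    (- / (4 * sqrt (f t)) * (df / 2) / f t).
Proof.
  intros Hf Hpos. pose proof (sqrt_lt_R0 _ Hpos) as Hs.
  evar_last.
  - apply (is_derive_comp (fun u => / (4 * sqrt u)) f t); [|exact Hf].
    auto_derive; [|reflexivity]. repeat split; lra.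
  - unfold scal; simpl; unfold mult; simpl.
    rewrite <- (sqrt_sqrt (f t)) at 5 by lra. field. lra.
Qed.

(** [1 / (4 |q|)] is homogeneous of degree [-1] and radial, whence its gradient
    is [- q / |q|^2] times itself. *)
Lemma partial_ds1 (i j k : coord) (q : C) : q <> 0%C ->
  partial k (ds1 i j) q =
  - ds1 i j q * proj k q / (fst q * fst q + snd q * snd q).
Proof.
  intros Hq. pose proof (sum_sqr_gt_0 q Hq) as Hm.
  destruct q as [x y]; simpl in Hm.
  assert (Hm' : 0 < x ^ 2 + y ^ 2) by lra.
  destruct i, j, k; unfold partial, ds1; simpl fst; simpl snd; simpl proj;
    try (rewrite Derive_const; field; lra);
    apply is_derive_unique; unfold Cmod; simpl fst; simpl snd.
  all: evar_last; [apply is_derive_inv_4_sqrt; [auto_derive; [trivial|reflexivity]|lra]|].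
  all: replace (x * x + y * y) with (x ^ 2 + y ^ 2) by ring; field; split;
    first [apply Rgt_not_eq, sqrt_lt_R0; lra | lra].
Qed.

(** For a conformal metric [exp (f) |dq|^2] the quadratic part of the geodesic
    equation is [(df . v) v - |v|^2 grad f / 2]; here [grad f = - q / |q|^2].
    This form is rational in the coordinates: the norm, a square root,
    has cancelled. *)
Lemma christoffel_ds1_sum (v : coord -> R) (k : coord) (q : C) : q <> 0%C ->
  sum_coord (fun i => sum_coord (fun j => christoffel ds1 k i j q * v i * v j)) =
  (/ 2 * (v X * v X + v Y * v Y) * proj k q
     - (fst q * v X + snd q * v Y) * v k) / (fst q * fst q + snd q * snd q).
Proof.
  intros Hq. pose proof (sum_sqr_gt_0 q Hq) as Hm.
  pose proof (proj1 (Cmod_gt_0 q) Hq) as Hr.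
  unfold christoffel, sum_coord.
  rewrite !partial_ds1 by exact Hq.
  destruct q as [x y]; simpl in Hm.
  unfold metric_inv, metric_det, ds1.
  destruct k; simpl fst; simpl snd; simpl proj;
    field; split; lra.
Qed.

(** The pull-back of the metric by the squaring map is the Euclidean metric, so
    the squaring map sends straight lines to geodesics, with the affine parameter.
    In complex notation the geodesic equation reads
    [q'' = q'^2 / (2 q)], which [q = Q^2] with [Q'' = 0] satisfies. *)
Lemma squared_line_geodesic (P V : C) :
  (forall t, affine P V t <> 0%C) -> geodesic ds1 punctured_plane (squared_line P V).
Proof.
  intros H0 t. specialize (H0 t).
  assert (Hq : squared_line P V t <> 0%C).
  { apply Cmod_gt_0. unfold squared_line. rewrite Cmod_square.
    apply Cmod_gt_0 in H0. nra. }
  split; [exact Hq|]. intros k. split; [|split].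
  - eexists. apply is_derive_squared_line.
  - eexists. apply is_derive_velocity_squared_line.
  - rewrite (christoffel_ds1_sum (fun i => velocity (squared_line P V) i t)) by exact Hq.
    rewrite (is_derive_unique _ _ _ (is_derive_velocity_squared_line P V k t)).
    rewrite !velocity_squared_line. unfold squared_line.
    apply sum_sqr_gt_0 in H0.
    destruct (affine P V t) as [a b], V as [c d]; simpl in H0.
    destruct k; simpl; field;
      nra.
Qed.

(** * Parabolas with focus at the origin *)

Lemma Glb_Rbar_attained (E : R -> Prop) (m : R) :
  E m -> (forall x, E x -> m <= x) -> Glb_Rbar E = Finite m.
Proof.
  intros Hm Hlow. apply is_glb_Rbar_unique. split.
  - intros x Hx. exact (Hlow x Hx).
  - intros b Hb. exact (Hb m Hm).
Qed.

(** If [D] is the foot of the perpendicular from the origin, the line consists of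
    the points [D (1 + i t)]; [w] is a square root of [D / 2], so that the vertex
    of the parabola with this directrix and focus at the origin is [w^2]. *)
Lemma line_off_origin (ell : C -> Prop) : line ell -> ~ ell 0%C ->
  exists w : C, w <> 0%C /\
    forall q, ell q <-> exists t : R, q = (w ^ 2 * (2, 2 * t)%R)%C.
Proof.
  intros [P [V [HV Hell]]] H0.
  pose proof (sum_sqr_gt_0 V HV) as HV2.
  destruct P as [p1 p2], V as [v1 v2]; simpl in HV2.
  set (s0 := - (p1 * v1 + p2 * v2) / (v1 * v1 + v2 * v2)).
  set (d1 := p1 + s0 * v1). set (d2 := p2 + s0 * v2).
  assert (Hperp : d1 * v1 + d2 * v2 = 0) by (unfold d1, d2, s0; field; lra).
  assert (HD : 0 < d1 * d1 + d2 * d2).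
  { destruct (Rle_lt_dec (d1 * d1 + d2 * d2) 0) as [Hle|]; [|assumption].
    exfalso. apply H0. rewrite Hell. exists s0.
    assert (d1 = 0) by nra. assert (d2 = 0) by nra.
    apply injective_projections; simpl; unfold d1, d2 in *; lra. }
  (* [V] is orthogonal to [D], hence the multiple [kap] of [i D]. *)
  set (kap := (v2 * d1 - v1 * d2) / (d1 * d1 + d2 * d2)).
  assert (Hv1 : v1 = - kap * d2).
  { unfold kap. replace v1 with ((v1 * (d1 * d1 + d2 * d2)) / (d1 * d1 + d2 * d2)) at 1
      by (field; lra).
    replace (v1 * (d1 * d1 + d2 * d2))
      with (d1 * (d1 * v1 + d2 * v2) - (v2 * d1 - v1 * d2) * d2) by ring.
    rewrite Hperp. field. lra. }
  assert (Hv2 : v2 = kap * d1).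
  { unfold kap. replace v2 with ((v2 * (d1 * d1 + d2 * d2)) / (d1 * d1 + d2 * d2)) at 1
      by (field; lra).
    replace (v2 * (d1 * d1 + d2 * d2))
      with (d2 * (d1 * v1 + d2 * v2) + (v2 * d1 - v1 * d2) * d1) by ring.
    rewrite Hperp. field. lra. }
  assert (Hkap : kap <> 0) by (intros Hk; rewrite Hk in Hv1, Hv2; nra).
  destruct (C_square_root (d1 / 2, d2 / 2)) as [w Hw].
  exists w. split.
  { intros ->. assert (E1 := f_equal fst Hw). assert (E2 := f_equal snd Hw).
    simpl in E1, E2. nra. }
  intros q. rewrite Hw, Hell. clear Hell H0.
  assert (Hp1 : p1 = d1 - s0 * v1) by (unfold d1; ring).
  assert (Hp2 : p2 = d2 - s0 * v2) by (unfold d2; ring).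
  clearbody d1 d2 kap s0. subst p1 p2 v1 v2.
  split; intros [t ->].
  - exists (kap * (t - s0)). apply injective_projections; simpl; field.
  - exists (t / kap + s0). apply injective_projections; simpl; field; assumption.
Qed.

(** Multiplication by [w^2] is a similarity, which carries the vertical line of
    abscissa [2] to the given one. *)
Lemma dist_to_line (w : C) (a b : R) (ell : C -> Prop) :
  (forall q, ell q <-> exists t : R, q = (w ^ 2 * (2, 2 * t)%R)%C) ->
  set_dist (eq (w ^ 2 * (a, b))%C) ell = Finite (Cmod (w ^ 2) * Rabs (a - 2)).
Proof.
  intros Hell. pose proof (Cmod_ge_0 (w ^ 2)) as Hw0. apply Glb_Rbar_attained.
  - exists (w ^ 2 * (a, b))%C, (w ^ 2 * (2, 2 * (b / 2))%R)%C.
    split; [reflexivity|]. split; [apply Hell; eauto|].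
    rewrite <- Cmod_R, <- Cmod_mult. f_equal.
    apply injective_projections; simpl; field.
  - intros r [p [p' [<- [Hp' ->]]]]. apply Hell in Hp'. destruct Hp' as [t ->].
    replace (w ^ 2 * (a, b) - w ^ 2 * (2, 2 * t)%R)%C
      with (w ^ 2 * ((a - 2)%R, (b - 2 * t)%R))%C
      by (apply injective_projections; simpl; ring).
    rewrite Cmod_mult. apply Rmult_le_compat_l; [exact Hw0|].
    exact (re_le_Cmod ((a - 2)%R, (b - 2 * t)%R)).
Qed.

(** After division by [w^2] the directrix is [a = 2], and the parabola
    [a^2 + b^2 = (a - 2)^2] is [b^2 = 4 (1 - a)]: it is traced by
    [(1 + i t)^2 = 1 - t^2 + 2 i t]. *)
Lemma kepler_parabola_squared_line (S : C -> Prop) : kepler_parabola S ->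
  exists w : C, w <> 0%C /\
    forall q, S q <-> exists t, squared_line w (Ci * w) t = q.
Proof.
  intros [ell [Hline [H0 HS]]].
  destruct (line_off_origin ell Hline H0) as [w [Hw Hell]].
  exists w. split; [exact Hw|]. intros q. rewrite HS.
  assert (Hw2 : (w ^ 2 <> 0)%C) by (simpl; rewrite Cmult_1_r; apply Cmult_neq_0; exact Hw).
  assert (Hm : 0 < Cmod (w ^ 2)) by (apply Cmod_gt_0; exact Hw2).
  remember (q / w ^ 2)%C as z eqn:Hz. destruct z as [a b].
  assert (Hq : q = (w ^ 2 * (a, b))%C) by (rewrite Hz; field; exact Hw).
  rewrite Hq, (dist_to_line w a b ell Hell), Rbar_finite_eq.
  replace (w ^ 2 * (a, b) - RtoC 0)%C with (w ^ 2 * (a, b))%C by ring.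
  rewrite Cmod_mult.
  assert (Hsq : forall t, squared_line w (Ci * w) t = (w ^ 2 * (1 - t * t, 2 * t)%R)%C).
  { intros t. unfold squared_line, affine. apply injective_projections; simpl; ring. }
  split.
  - intros H. apply Rmult_eq_reg_l in H; [|lra].
    pose proof (Cmod_sqr (a, b)) as Hab. rewrite H, <- Rabs_mult in Hab. simpl in Hab.
    rewrite Rabs_pos_eq in Hab by apply Rle_0_sqr.
    (* The ordinate of the curve is [2 t]. *)
    exists (b / 2). rewrite Hsq. f_equal. apply injective_projections; simpl; lra.
  - intros [t Ht]. rewrite Hsq in Ht. f_equal.
    assert (E : ((1 - t * t, 2 * t)%R : C) = (a, b)).
    { replace ((1 - t * t, 2 * t)%R : C)
        with (/ w ^ 2 * (w ^ 2 * (1 - t * t, 2 * t)%R))%C by (field; exact Hw).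
      rewrite Ht. field. exact Hw. }
    injection E as <- <-.
    apply Cmod_unique; [apply Rabs_pos|].
    rewrite <- Rabs_mult, Rabs_pos_eq by apply Rle_0_sqr. simpl. ring.
Qed.

Lemma kepler_parabola_geodesic (S : C -> Prop) : kepler_parabola S ->
  geodesic_up_to_reparameterization ds1 punctured_plane S.
Proof.
  intros HS. destruct (kepler_parabola_squared_line S HS) as [w [Hw HSq]].
  assert (Hlin : forall t, affine w (Ci * w) t = (w * (1, t)%R)%C)
    by (intros t; unfold affine; apply injective_projections; simpl; ring).
  assert (Hlin0 : forall t, affine w (Ci * w) t <> 0%C).
  { intros t. rewrite Hlin. apply Cmult_neq_0; [exact Hw|].
    intros E. injection E. lra. }
  exists (squared_line w (Ci * w)). split; [|apply squared_line_geodesic; exact Hlin0].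
  split; [|split].
  - intros t. split; [apply C1_squared_line|].
    assert (Hv : (2 * (Ci * w * affine w (Ci * w) t) <> 0)%C).
    { repeat apply Cmult_neq_0; auto; intros E; injection E; lra. }
    apply sum_sqr_gt_0 in Hv.
    destruct (Req_dec (velocity (squared_line w (Ci * w)) X t) 0) as [HX|HX];
      [|exists X; exact HX].
    exists Y. rewrite velocity_squared_line in *. unfold proj in *. intros HY.
    rewrite HX, HY in Hv. lra.
  - intros s t E. unfold squared_line in E. rewrite !Hlin in E.
    assert (E1 : ((1, s)%R ^ 2 = (1, t)%R ^ 2)%C).
    { replace ((1, s)%R ^ 2)%C with (/ w ^ 2 * (w * (1, s)%R) ^ 2)%C by (field; exact Hw).
      rewrite E. field. exact Hw. }
    apply (f_equal snd) in E1. simpl in E1. lra.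
  - exact HSq.
Qed.

(** * The distance of the Kepler cone *)

(** The distance in the cone between the orbits of [P] and [Q]. *)
Definition cone_gap (P Q : C) : R := Rmin (Cmod (P - Q)) (Cmod (P + Q)).

Lemma Cmod_sub_sym (P Q : C) : Cmod (P - Q) = Cmod (Q - P).
Proof. rewrite <- Cmod_opp. f_equal. ring. Qed.

Lemma cone_gap_sym (P Q : C) : cone_gap P Q = cone_gap Q P.
Proof.
  unfold cone_gap. rewrite (Cmod_sub_sym P Q), (Cplus_comm P Q). reflexivity.
Qed.

Lemma cone_gap_opp (P Q : C) : cone_gap (- P) Q = cone_gap P Q.
Proof.
  unfold cone_gap. rewrite Rmin_comm. f_equal; rewrite <- Cmod_opp; f_equal; ring.
Qed.

Lemma cone_gap_square_eq (P P' Q Q' : C) :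
  (P ^ 2 = P' ^ 2)%C -> (Q ^ 2 = Q' ^ 2)%C -> cone_gap P Q = cone_gap P' Q'.
Proof.
  intros HP HQ.
  transitivity (cone_gap P' Q).
  - destruct (C_square_eq P P' HP) as [-> | ->]; [|rewrite cone_gap_opp]; reflexivity.
  - rewrite !(cone_gap_sym P').
    destruct (C_square_eq Q Q' HQ) as [-> | ->]; [|rewrite cone_gap_opp]; reflexivity.
Qed.

Lemma cone_gap_diag (P : C) : cone_gap P P = 0.
Proof.
  unfold cone_gap. replace (P - P)%C with (RtoC 0) by ring. rewrite Cmod_0.
  apply Rmin_left, Cmod_ge_0.
Qed.

(** The sign of the middle representative may be changed freely, so it may be taken
    nearest to [T]. *)
Lemma cone_gap_triangle (P Q T : C) : cone_gap P T <= cone_gap P Q + cone_gap Q T.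
Proof.
  assert (H : forall Q', cone_gap P T <= cone_gap P Q' + Cmod (Q' - T)).
  { intros Q'.
    pose proof (Cmod_triangle (P - Q') (Q' - T)) as H1.
    pose proof (Cmod_triangle (P + Q') (- (Q' - T))) as H2. rewrite Cmod_opp in H2.
    replace (P - Q' + (Q' - T))%C with (P - T)%C in H1 by ring.
    replace (P + Q' + - (Q' - T))%C with (P + T)%C in H2 by ring.
    unfold cone_gap. do 2 apply Rmin_case_strong; intros; lra. }
  pose proof (H Q) as H1. pose proof (H (- Q)%C) as H2.
  rewrite (cone_gap_sym P (- Q)), cone_gap_opp, (cone_gap_sym Q P) in H2.
  rewrite <- (Cmod_opp (- Q - T)) in H2.
  replace (- (- Q - T))%C with (Q + T)%C in H2 by ring.
  unfold cone_gap at 3. apply Rmin_case; assumption.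
Qed.

Lemma cone_gap_choose (P Q : C) : exists Q' : C,
  (Q' ^ 2 = Q ^ 2)%C /\ cone_gap P Q = Cmod (P - Q') /\ Cmod (P - Q') <= Cmod (P + Q').
Proof.
  unfold cone_gap. destruct (Rle_dec (Cmod (P - Q)) (Cmod (P + Q))) as [H|H].
  - exists Q. rewrite Rmin_left; auto.
  - exists (- Q)%C. replace (P - - Q)%C with (P + Q)%C by ring.
    replace (P + - Q)%C with (P - Q)%C by ring.
    rewrite Rmin_right by lra. split; [ring|]. split; [reflexivity|lra].
Qed.

Lemma Cmod_diff_squares (P Q : C) :
  Cmod (P ^ 2 - Q ^ 2) = Cmod (P - Q) * Cmod (P + Q).
Proof. rewrite <- Cmod_mult. f_equal. ring. Qed.

Lemma cone_gap_sqr_le (P Q : C) : cone_gap P Q * cone_gap P Q <= Cmod (P ^ 2 - Q ^ 2).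
Proof.
  destruct (cone_gap_choose P Q) as [Q' [HQ [-> Hle]]].
  rewrite <- HQ, Cmod_diff_squares.
  apply Rmult_le_compat_l; [apply Cmod_ge_0|exact Hle].
Qed.

(** With [r = |P|], [g] the gap and [s] the larger of [|P - Q|], [|P + Q|], one has
    [g s = m] and [g + s >= 2 r]. Hence [s >= r], so [g <= m / r], and
    [2 r g <= m + g^2]. To first order the gap is [|dq| / (2 r)], which is the
    length element of the metric at [P^2]. *)
Lemma cone_gap_near (P Q : C) : P <> 0%C ->
  let m := Cmod (P ^ 2 - Q ^ 2) in
  2 * Cmod P * cone_gap P Q <= m + m * m / (Cmod P * Cmod P).
Proof.
  intros HP m. apply Cmod_gt_0 in HP.
  destruct (cone_gap_choose P Q) as [Q' [HQ [-> Hle]]].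
  assert (Hm : m = Cmod (P - Q') * Cmod (P + Q'))
    by (unfold m; rewrite <- HQ; apply Cmod_diff_squares).
  clearbody m. subst m.
  pose proof (Cmod_triangle (P - Q') (P + Q')) as Ht.
  replace (P - Q' + (P + Q'))%C with (2 * P)%C in Ht by ring.
  rewrite Cmod_mult, Cmod_R, Rabs_pos_eq in Ht by lra.
  pose proof (Cmod_ge_0 (P - Q')) as Hg0.
  set (g := Cmod (P - Q')) in *. set (s := Cmod (P + Q')) in *. set (r := Cmod P) in *.
  assert (Hgs : g * g <= g * s * (g * s) / (r * r)).
  { apply Rmult_le_reg_r with (r * r); [nra|].
    replace (g * s * (g * s) / (r * r) * (r * r)) with (g * g * (s * s))
      by (field; lra).
    apply Rmult_le_compat_l; nra. }
  nra.
Qed.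

Lemma Glb_Rbar_pair (E : R -> Prop) (a b : R) :
  (forall r, E r <-> r = a \/ r = b) -> Glb_Rbar E = Finite (Rmin a b).
Proof.
  intros H. apply Glb_Rbar_attained.
  - apply H. apply Rmin_case; auto.
  - intros x Hx. apply H in Hx. destruct Hx as [-> | ->]; [apply Rmin_l|apply Rmin_r].
Qed.

Lemma set_dist_orbit (P Q : C) : set_dist (orbit P) (orbit Q) = Finite (cone_gap P Q).
Proof.
  apply Glb_Rbar_pair. intros r. split.
  - intros [P' [Q' [[-> | ->] [[-> | ->] ->]]]]; [left|right|right|left];
      first [f_equal; ring | rewrite <- Cmod_opp; f_equal; ring].
  - intros [-> | ->].
    + exists P, Q. split; [now left|]. split; [now left|]. reflexivity.
    + exists P, (- Q)%C. split; [now left|]. split; [now right|]. f_equal. ring.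
Qed.

Lemma speed_ds1 (gam : R -> C) (t : R) : gam t <> 0%C ->
  speed ds1 gam t =
  Cmod (velocity gam X t, velocity gam Y t) / (2 * sqrt (Cmod (gam t))).
Proof.
  intros H. apply Cmod_gt_0 in H. revert H.
  unfold speed, sum_coord, ds1, Cmod. simpl fst; simpl snd.
  set (r := sqrt (fst (gam t) ^ 2 + snd (gam t) ^ 2)).
  intros Hr.
  set (v := velocity gam X t). set (w := velocity gam Y t).
  replace (/ (4 * r) * v * v + 0 * v * w + (0 * w * v + / (4 * r) * w * w))
    with ((v ^ 2 + w ^ 2) / (4 * r)) by (unfold Rdiv; ring).
  replace (2 * sqrt r) with (sqrt (4 * r)).
  - apply sqrt_div_alt. lra.
  - rewrite sqrt_mult by lra. replace 4 with (2 * 2) by ring.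
    rewrite sqrt_square by lra. reflexivity.
Qed.

(** * Curves are at least as long as the distance in the cone *)

Lemma increment_le (gam : R -> C) (c eta : R) :
  (forall k, ex_derive (component gam k) c) -> 0 < eta ->
  exists delta, 0 < delta /\ forall t, Rabs (t - c) < delta ->
    Cmod (gam t - gam c) <=
      (Cmod (velocity gam X c, velocity gam Y c) + eta) * Rabs (t - c).
Proof.
  intros Hd Heta.
  assert (Hk : forall k, exists delta, 0 < delta /\ forall t, Rabs (t - c) < delta ->
    Rabs (component gam k t - component gam k c - velocity gam k c * (t - c))
      <= eta / 2 * Rabs (t - c)).
  { intros k. pose proof (Derive_correct _ _ (Hd k)) as H.
    apply is_derive_Reals in H.
    destruct (H (eta / 2) ltac:(lra)) as [delta Hdelta].
    exists delta. split; [apply cond_pos|]. intros t Ht.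
    destruct (Req_dec t c) as [->|Hne].
    { replace (_ - _ - _) with 0 by ring. rewrite Rminus_diag, Rabs_R0. lra. }
    specialize (Hdelta (t - c) ltac:(lra) Ht).
    replace (c + (t - c)) with t in Hdelta by ring.
    fold (velocity gam k c) in Hdelta.
    replace (component gam k t - component gam k c - velocity gam k c * (t - c)) with
      (((component gam k t - component gam k c) / (t - c) - velocity gam k c) * (t - c))
      by (field; lra).
    rewrite Rabs_mult. apply Rmult_le_compat_r; [apply Rabs_pos|lra]. }
  destruct (Hk X) as [dx [Hdx HX]]. destruct (Hk Y) as [dy [Hdy HY]].
  exists (Rmin dx dy). split; [apply Rmin_pos; assumption|].
  intros t Ht.
  specialize (HX t (Rlt_le_trans _ _ _ Ht (Rmin_l _ _))).
  specialize (HY t (Rlt_le_trans _ _ _ Ht (Rmin_r _ _))).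
  unfold component in HX, HY. simpl proj in HX, HY.
  set (vx := velocity gam X c) in *. set (vy := velocity gam Y c) in *.
  set (ex := _ - _ - _) in HX. set (ey := _ - _ - _) in HY.
  replace (gam t - gam c)%C with (RtoC (t - c) * (vx, vy) + (ex, ey))%C
    by (apply injective_projections; unfold ex, ey; simpl; ring).
  eapply Rle_trans; [apply Cmod_triangle|].
  rewrite Cmod_mult, Cmod_R.
  assert (Cmod (ex, ey) <= eta * Rabs (t - c)); [|lra].
  pose proof (Rabs_pos (t - c)). pose proof (Rabs_pos ex). pose proof (Rabs_pos ey).
  apply le_Cmod; simpl; [nra|].
  rewrite <- (Rabs_pos_eq (ex * ex)), <- (Rabs_pos_eq (ey * ey)), !Rabs_mult
    by apply Rle_0_sqr.
  nra.
Qed.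

(** [Q] is an arbitrary choice of square roots, not assumed continuous: the gap is
    insensitive to the signs. *)
Lemma lift_increment_le (gam Q : R -> C) (c eps : R) :
  (forall t, (Q t ^ 2)%C = gam t) -> gam c <> 0%C ->
  (forall k, ex_derive (component gam k) c) -> 0 < eps ->
  exists delta, 0 < delta /\ forall t, Rabs (t - c) < delta ->
    cone_gap (Q c) (Q t) <= (speed ds1 gam c + eps) * Rabs (t - c).
Proof.
  intros HQ H0 Hd Heps.
  assert (HP : Q c <> 0%C) by (intros E; apply H0; rewrite <- HQ, E; ring).
  rewrite speed_ds1 by exact H0. 
  rewrite <- HQ, Cmod_square, sqrt_square by apply Cmod_ge_0.
  pose proof (proj1 (Cmod_gt_0 _) HP) as Hr.
  set (r := Cmod (Q c)) in *.
  destruct (increment_le gam c (r * eps) Hd ltac:(nra)) as [d1 [Hd1 H1]].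
  set (v := Cmod (velocity gam X c, velocity gam Y c)) in *.
  assert (Hv : 0 <= v) by apply Cmod_ge_0.
  assert (HW : 0 < v + r * eps) by nra.
  set (W := v + r * eps) in *.
  (* If [m <= W h], then [h < d2] gives [m^2 / r^2 <= r eps h], half of the error
     allowed. *)
  set (d2 := r * r * (r * eps) / (W * W)).
  assert (Hd2 : 0 < d2)
    by (unfold d2; apply Rdiv_lt_0_compat; repeat apply Rmult_lt_0_compat; assumption).
  exists (Rmin d1 d2). split; [apply Rmin_pos; assumption|].
  intros t Ht.
  specialize (H1 t (Rlt_le_trans _ _ _ Ht (Rmin_l _ _))).
  pose proof (Rlt_le_trans _ _ _ Ht (Rmin_r _ _)) as H2.
  pose proof (cone_gap_near (Q c) (Q t) HP) as Hg. cbv zeta in Hg.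
  rewrite !HQ, (Cmod_sub_sym (gam c)) in Hg. fold r in Hg.
  set (m := Cmod (gam t - gam c)) in *. set (h := Rabs (t - c)) in *.
  set (g := cone_gap (Q c) (Q t)) in *.
  assert (Hm0 : 0 <= m) by apply Cmod_ge_0. assert (Hh : 0 <= h) by apply Rabs_pos.
  assert (Hq : m * m / (r * r) <= r * eps * h).
  { apply Rle_trans with (W * W * h / (r * r) * h).
    - replace (W * W * h / (r * r) * h) with (W * h * (W * h) / (r * r)) by (field; lra).
      apply Rmult_le_compat_r; [apply Rlt_le, Rinv_0_lt_compat; nra|].
      apply Rmult_le_compat; lra.
    - apply Rmult_le_compat_r; [exact Hh|].
      apply Rle_trans with (W * W * d2 / (r * r)).
      + apply Rmult_le_compat_r; [apply Rlt_le, Rinv_0_lt_compat; nra|].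
        apply Rmult_le_compat_l; nra.
      + right. unfold d2. field. lra. }
  apply Rmult_le_reg_l with (2 * r); [lra|].
  replace (2 * r * ((v / (2 * r) + eps) * h)) with (W * h + r * eps * h)
    by (unfold W; field; lra).
  lra.
Qed.

(** The points [x] with [D a x <= eps (x - a)] form a set whose supremum
    belongs to it and cannot be smaller than [b], because the local bound and
    subadditivity carry the inequality from just before the supremum to just after. *)
Lemma subadditive_local_to_global (D : R -> R -> R) (a b eps : R) :
  a <= b ->
  (forall r s t, a <= r <= s -> s <= t <= b -> D r t <= D r s + D s t) ->
  (forall c, a <= c <= b -> exists delta, 0 < delta /\
     forall s t, a <= s <= c -> c <= t <= b -> t - s < delta ->
       D s t <= eps * (t - s)) ->
  D a b <= eps * (b - a).
Proof.
  intros Hab Hsub Hloc.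
  set (E := fun x => a <= x <= b /\ D a x <= eps * (x - a)).
  assert (Ea : E a).
  { split; [lra|]. destruct (Hloc a) as [d [Hd H]]; [lra|]. apply H; lra. }
  destruct (completeness E) as [c [Hub Hlub]].
  { exists b. intros x [Hx _]. lra. }
  { exists a. exact Ea. }
  assert (Hc : a <= c <= b).
  { split; [apply Hub, Ea|]. apply Hlub. intros x [Hx _]. lra. }
  destruct (Hloc c Hc) as [d [Hd Hdc]].
  assert (Hs : exists s, E s /\ c - d / 2 < s).
  { apply Classical_Prop.NNPP. intros Hn.
    assert (c <= c - d / 2); [|lra].
    apply Hlub. intros x Hx. apply Rnot_lt_le. intros Hlt. apply Hn. eauto. }
  destruct Hs as [s [[Hs HDs] Hcs]].
  assert (Hsc : s <= c) by (apply Hub; split; assumption).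
  assert (Hext : forall t, c <= t <= b -> t < c + d / 2 -> E t).
  { intros t Ht Htd. split; [lra|].
    pose proof (Hsub a s t ltac:(lra) ltac:(lra)).
    pose proof (Hdc s t ltac:(lra) ltac:(lra) ltac:(lra)). lra. }
  destruct (Rlt_le_dec c b) as [Hlt|Hge].
  - assert (Ht : E (Rmin b (c + d / 4))).
    { apply Hext; [split; [apply Rmin_glb; lra|apply Rmin_l]|].
      pose proof (Rmin_r b (c + d / 4)). lra. }
    apply Hub in Ht. exfalso. revert Ht. apply Rmin_case; lra.
  - replace b with c by lra. apply Hext; lra.
Qed.

Lemma continuous_component (gam : R -> C) (t : R) :
  C1_at gam t -> forall k, continuous (component gam k) t.
Proof.
  intros H k. apply (@ex_derive_continuous R_AbsRing R_NormedModule), H.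
Qed.

Lemma continuous_speed (gam : R -> C) (t : R) :
  C1_at gam t -> gam t <> 0%C -> continuous (speed ds1 gam) t.
Proof.
  intros HC H0. apply Cmod_gt_0 in H0.
  pose proof (continuous_component gam t HC) as Hk.
  assert (Hv : forall k, continuous (velocity gam k) t) by (intros k; apply HC).
  assert (Hmod : continuous (fun s => Cmod (gam s)) t).
  { apply (continuous_ext (fun s =>
      sqrt (component gam X s * component gam X s + component gam Y s * component gam Y s))).
    - intros s. unfold Cmod, component. simpl. f_equal. ring.
    - apply continuous_sqrt_comp.
      apply (@continuous_plus _ R_AbsRing R_NormedModule);
        apply (@continuous_mult _ R_AbsRing); apply Hk. }
  assert (Hinv : continuous (fun s => / (4 * Cmod (gam s))) t).
  { apply continuous_Rinv_comp; [|lra].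
    apply (@continuous_mult _ R_AbsRing); [apply continuous_const|exact Hmod]. }
  unfold speed, sum_coord, ds1. apply continuous_sqrt_comp.
  repeat (first [apply Hv | exact Hinv | apply continuous_const
    | apply (@continuous_plus _ R_AbsRing R_NormedModule)
    | apply (@continuous_mult _ R_AbsRing)]).
Qed.

(** The function [D s t], the gap between [s] and [t] minus the length of the
    curve between them, is subadditive, and is locally at most
    [2 eps (t - s)] for every [eps > 0]: near a point [c], to first order, the gap
    is at most [speed c (t - s)] and the length is equal to it. Hence [D a b]
    cannot be positive. *)
Lemma cone_gap_le_length (gam Q : R -> C) (a b : R) :
  a <= b -> (forall t, (Q t ^ 2)%C = gam t) ->
  (forall t, a <= t <= b -> gam t <> 0%C /\ C1_at gam t) ->
  cone_gap (Q a) (Q b) <= RInt (speed ds1 gam) a b.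
Proof.
  intros Hab HQ Hreg. set (sp := speed ds1 gam).
  assert (Hex : forall s t, a <= s -> s <= t -> t <= b -> ex_RInt sp s t).
  { intros s t H1 H2 H3. apply (@ex_RInt_continuous R_CompleteNormedModule).
    rewrite Rmin_left, Rmax_right by exact H2.
    intros z Hz. destruct (Hreg z ltac:(lra)). apply continuous_speed; assumption. }
  apply Rnot_lt_le. intros Hlt.
  set (gap := cone_gap (Q a) (Q b) - RInt sp a b).
  assert (Hgap : 0 < gap) by (unfold gap; lra).
  (* Small enough for [2 eps (b - a) < gap], also when [a = b]. *)
  set (eps := gap / (4 * (b - a + 1))).
  assert (Heps : 0 < eps) by (apply Rdiv_lt_0_compat; lra).
  assert (Hglob : gap <= 2 * eps * (b - a)).
  { apply (subadditive_local_to_global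
      (fun s t => cone_gap (Q s) (Q t) - RInt sp s t)); [exact Hab| |].
    - intros r s t Hr Ht. pose proof (cone_gap_triangle (Q r) (Q s) (Q t)).
      rewrite <- (RInt_Chasles sp r s t) by (apply Hex; lra).
      unfold plus; simpl. lra.
    - intros c Hc. destruct (Hreg c Hc) as [H0 HC].
      destruct (lift_increment_le gam Q c eps HQ H0 (fun k => proj1 (HC k)) Heps)
        as [d1 [Hd1 H1]].
      pose proof (continuous_speed gam c HC H0) as Hcont.
      apply continuity_pt_filterlim in Hcont.
      destruct (Hcont eps Heps) as [d2 [Hd2 H2]].
      exists (Rmin d1 d2). split; [apply Rmin_pos; assumption|].
      intros s t Hs Ht Hst.
      pose proof (Rlt_le_trans _ _ _ Hst (Rmin_l _ _)) as Hst1.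
      pose proof (Rlt_le_trans _ _ _ Hst (Rmin_r _ _)) as Hst2.
      pose proof (cone_gap_triangle (Q s) (Q c) (Q t)) as Htri.
      rewrite (cone_gap_sym (Q s) (Q c)) in Htri.
      pose proof (H1 s) as H1s. pose proof (H1 t) as H1t. fold sp in H1s, H1t.
      rewrite Rabs_left1 in H1s by lra. rewrite Rabs_right in H1t by lra.
      specialize (H1s ltac:(lra)). specialize (H1t ltac:(lra)).
      assert (HI : (t - s) * (sp c - eps) <= RInt sp s t).
      { replace ((t - s) * (sp c - eps)) with (RInt (fun _ => sp c - eps) s t)
          by (rewrite RInt_const; reflexivity).
        apply RInt_le; [lra|apply ex_RInt_const|apply Hex; lra|].
        intros x Hx. destruct (Req_dec x c) as [->|Hne]; [lra|].
        assert (Hdist : Rabs (sp x - sp c) < eps).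
        { apply (H2 x). split; [split; [exact I|auto]|].
          apply Rabs_def1; simpl; lra. }
        apply Rabs_def2 in Hdist. lra. }
      lra. }
  assert (gap = eps * (4 * (b - a + 1))) by (unfold eps; field; lra).
  nra.
Qed.

Lemma continuous_on_Cmod (A : R -> Prop) (gam : R -> C) (t eps : R) :
  continuous_on A gam -> A t -> 0 < eps ->
  within A (locally t) (fun s => Cmod (gam s - gam t) < eps).
Proof.
  intros Hc Ht Heps. specialize (Hc t Ht).
  assert (He : 0 < eps / 2) by lra.
  pose proof (proj1 (filterlim_locally gam (gam t)) Hc (mkposreal _ He)) as H.
  revert H. apply filter_imp. intros s Hs.
  apply C_NormedModule_mixin_compat2 in Hs. simpl in Hs.
  eapply Rlt_le_trans; [exact Hs|].
  assert (sqrt 2 <= 2); [|nra].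
  apply Rsqr_incr_0; [|apply sqrt_pos|lra]. rewrite Rsqr_sqrt; unfold Rsqr; lra.
Qed.

(** The gap is a Hoelder function of the squares even at the apex, where the speed
    is not defined. *)
Lemma cone_gap_small (P Q : C) (eps : R) :
  0 < eps -> Cmod (Q ^ 2 - P ^ 2) < eps * eps -> cone_gap P Q < eps.
Proof.
  intros Heps H. rewrite Cmod_sub_sym in H. pose proof (cone_gap_sqr_le P Q). nra.
Qed.

(** Near the endpoints the arc is only continuous: the inner part is bounded by the
    length, and the two ends contribute arbitrarily little. *)
Lemma cone_gap_le_arc (gam : R -> C) (a b L : R) (P T : C) :
  arc ds1 punctured_plane gam a b L ->
  (P ^ 2)%C = gam a -> (T ^ 2)%C = gam b -> cone_gap P T <= L.
Proof.
  intros [Hab [Hcont [Hreg HL]]] HP HT.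
  destruct (functional_choice (fun t Q => (Q ^ 2)%C = gam t)
    (fun t => C_square_root (gam t))) as [Q HQ].
  apply Rnot_lt_le. intros Hlt.
  (* One third of the excess for each of the two ends and for the improper integral. *)
  set (eps := (cone_gap P T - L) / 3). assert (Heps : 0 < eps) by (unfold eps; lra).
  set (mid := (a + b) / 2).
  destruct (HL (fun y => y < L + eps)) as [A B HA HB HAB].
  { exists (mkposreal eps Heps). intros y Hy. apply Rabs_def2 in Hy.
    unfold minus, plus, opp in Hy; simpl in Hy. lra. }
  assert (Halpha : exists s, A s /\ a < s < mid /\ Cmod (gam s - gam a) < eps * eps).
  { apply (filter_ex (F := at_right a)). apply filter_and; [exact HA|].
    assert (H1 : locally a (fun s => s < mid)) by (apply open_lt; unfold mid; lra).
    pose proof (continuous_on_Cmod _ gam a (eps * eps) Hcont ltac:(lra) ltac:(nra)) as H2.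
    generalize (filter_and _ _ H1 H2). unfold at_right, at_left, within.
    apply filter_imp.
    intros s [Hs1 Hs2] Hs. unfold mid in *. split; [lra|]. apply Hs2. lra. }
  assert (Hbeta : exists t, B t /\ mid < t < b /\ Cmod (gam t - gam b) < eps * eps).
  { apply (filter_ex (F := at_left b)). apply filter_and; [exact HB|].
    assert (H1 : locally b (fun s => mid < s)) by (apply open_gt; unfold mid; lra).
    pose proof (continuous_on_Cmod _ gam b (eps * eps) Hcont ltac:(lra) ltac:(nra)) as H2.
    generalize (filter_and _ _ H1 H2). unfold at_right, at_left, within.
    apply filter_imp.
    intros s [Hs1 Hs2] Hs. unfold mid in *. split; [lra|]. apply Hs2. lra. }
  destruct Halpha as [s [HAs [Hs Hsa]]]. destruct Hbeta as [t [HBt [Ht Htb]]].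
  destruct (HAB s t HAs HBt) as [y [Hy HyL]]. simpl in Hy.
  assert (Hmain : cone_gap (Q s) (Q t) <= y).
  { rewrite <- (is_RInt_unique _ _ _ _ Hy). apply cone_gap_le_length; [lra|exact HQ|].
    intros x Hx. apply (Hreg x). lra. }
  rewrite <- HP, <- HQ in Hsa. rewrite <- HT, <- HQ in Htb.
  apply cone_gap_small in Hsa; [|exact Heps]. apply cone_gap_small in Htb; [|exact Heps].
  rewrite cone_gap_sym in Htb.
  pose proof (cone_gap_triangle P (Q s) T). pose proof (cone_gap_triangle (Q s) (Q t) T).
  unfold eps in *. lra.
Qed.

(** Square roots of the junction points of consecutive arcs are chosen arbitrarily;
    the triangle inequality in the cone adds the bounds up. *)
Lemma cone_gap_le_joined (p q : C) (L : R) : joined ds1 punctured_plane p q L ->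
  forall P Q, (P ^ 2)%C = p -> (Q ^ 2)%C = q -> cone_gap P Q <= L.
Proof.
  induction 1 as [p|gam a b L q L' Harc _ IH]; intros P Q HP HQ.
  - rewrite (cone_gap_square_eq P Q Q Q), cone_gap_diag; [lra|congruence|reflexivity].
  - destruct (C_square_root (gam b)) as [T HT].
    pose proof (cone_gap_le_arc gam a b L P T Harc HP HT).
    pose proof (IH T Q HT HQ). pose proof (cone_gap_triangle P T Q). lra.
Qed.

(** * Squares of segments realize the distance *)

Lemma is_RInt_gen_const (a b l : R) :
  is_RInt_gen (fun _ => l) (at_right a) (at_left b) (l * (b - a)).
Proof.
  apply (is_RInt_gen_ext (Derive (fun t => l * t))).
  - apply filter_forall. intros ab x _. apply is_derive_unique. auto_derive; trivial. ring.
  - replace (l * (b - a)) with (l * b - l * a) by ring.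
    assert (Hd : forall x, is_derive (fun t => l * t) x l)
      by (intros x; auto_derive; trivial; ring).
    assert (Hc : forall x, continuous (fun t => l * t) x).
    { intros x. apply (@ex_derive_continuous R_AbsRing R_NormedModule).
      eexists. apply Hd. }
    apply is_RInt_gen_Derive.
    + apply filter_forall. intros ab x _. eexists. apply Hd.
    + apply filter_forall. intros ab x _. apply (continuous_ext (fun _ => l)).
      * intros s. symmetry. apply is_derive_unique, Hd.
      * apply continuous_const.
    + eapply filterlim_filter_le_1; [apply filter_le_within|apply Hc].
    + eapply filterlim_filter_le_1; [apply filter_le_within|apply Hc].
Qed.

Lemma is_RInt_gen_eq_const (f : R -> R) (a b l : R) :
  a < b -> (forall t, a < t < b -> f t = l) ->
  is_RInt_gen f (at_right a) (at_left b) (l * (b - a)).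
Proof.
  intros Hab Hf. apply (is_RInt_gen_ext (fun _ => l)); [|apply is_RInt_gen_const].
  set (mid := (a + b) / 2).
  exists (fun s => a < s < mid) (fun t => mid < t < b).
  - assert (H : locally a (fun s => s < mid)) by (apply open_lt; unfold mid; lra).
    revert H. unfold at_right, at_left, within. apply filter_imp. intros s H1 H2. lra.
  - assert (H : locally b (fun s => mid < s)) by (apply open_gt; unfold mid; lra).
    revert H. unfold at_right, at_left, within. apply filter_imp. intros s H1 H2. lra.
  - simpl. intros s t Hs Ht x. rewrite Rmin_left, Rmax_right by lra.
    intros Hx. symmetry. apply Hf. lra.
Qed.

(** The squaring map is a local isometry off the origin. *)
Lemma speed_squared_line (P V : C) (t : R) :
  affine P V t <> 0%C -> speed ds1 (squared_line P V) t = Cmod V.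
Proof.
  intros H0. pose proof (proj1 (Cmod_gt_0 _) H0) as Hr.
  rewrite speed_ds1.
  - rewrite !velocity_squared_line. unfold proj. rewrite <- surjective_pairing.
    unfold squared_line. rewrite Cmod_square, sqrt_square by lra.
    rewrite !Cmod_mult, Cmod_R, Rabs_pos_eq by lra. field. lra.
  - apply Cmod_gt_0. unfold squared_line. rewrite Cmod_square. nra.
Qed.

Lemma continuous_of_components (gam : R -> C) (t : R) :
  (forall k, continuous (component gam k) t) -> continuous gam t.
Proof.
  intros Hk. apply filterlim_locally. intros eps.
  pose proof (proj1 (filterlim_locally _ _) (Hk X) eps) as HX.
  pose proof (proj1 (filterlim_locally _ _) (Hk Y) eps) as HY.
  generalize (filter_and _ _ HX HY). apply filter_imp.
  intros s [Hx Hy]. split; assumption.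
Qed.

(** The hypothesis on the norms says that the scalar product of [P] and [Q] is
    nonnegative, so that the angle at the origin is at most a right angle. *)
Lemma segment_avoids_origin (P Q : C) (t : R) : P <> Q ->
  Cmod (P - Q) <= Cmod (P + Q) -> 0 < t < 1 -> affine P (Q - P) t <> 0%C.
Proof.
  intros Hne Hle Ht E.
  pose proof (Cmod_ge_0 (P - Q)) as H1.
  assert (Hsq : Cmod (P - Q) * Cmod (P - Q) <= Cmod (P + Q) * Cmod (P + Q)) by nra.
  rewrite !Cmod_sqr in Hsq.
  destruct P as [a b], Q as [c d]. unfold affine in E.
  pose proof (f_equal fst E) as E1. pose proof (f_equal snd E) as E2.
  simpl in E1, E2, Hsq.
  assert (Hac : 0 <= a * c + b * d) by nra.
  assert (F1 : (1 - t) * a = - t * c) by lra.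
  assert (F2 : (1 - t) * b = - t * d) by lra.
  assert (Hneg : (1 - t) * (a * c + b * d) = - t * (c * c + d * d)).
  { replace ((1 - t) * (a * c + b * d)) with ((1 - t) * a * c + (1 - t) * b * d) by ring.
    rewrite F1, F2. ring. }
  assert (Hcd : c * c + d * d = 0) by nra.
  assert (c = 0) by nra. assert (d = 0) by nra. subst c d.
  apply Hne. apply injective_projections; simpl; nra.
Qed.

(** The squared segment is a curve that realizes the distance. Choosing the nearer
    of the two square roots of the endpoint keeps the segment off the origin,
    except possibly at its ends, so at most one arc is needed. *)
Lemma joined_segment (P Q : C) : Cmod (P - Q) <= Cmod (P + Q) ->
  joined ds1 punctured_plane (P ^ 2)%C (Q ^ 2)%C (Cmod (P - Q)).
Proof.
  intros Hle. destruct (Req_dec (Cmod (P - Q)) 0) as [H0|H0].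
  { rewrite H0. apply Cmod_eq_0 in H0. replace Q with (P - (P - Q))%C by ring.
    rewrite H0. replace (P - 0)%C with P by ring. apply joined_refl. }
  assert (Hne : P <> Q).
  { intros ->. apply H0. replace (Q - Q)%C with (RtoC 0) by ring. apply Cmod_0. }
  replace (P ^ 2)%C with (squared_line P (Q - P) 0) by (unfold squared_line, affine; ring).
  replace (Q ^ 2)%C with (squared_line P (Q - P) 1) by (unfold squared_line, affine; ring).
  rewrite <- (Rplus_0_r (Cmod (P - Q))).
  apply joined_arc with 1; [|apply joined_refl].
  split; [lra|]. split; [|split].
  - apply continuous_on_forall. intros t _. apply continuous_of_components.
    apply continuous_component, C1_squared_line.
  - intros t Ht. split; [|apply C1_squared_line].
    pose proof (segment_avoids_origin P Q t Hne Hle Ht) as Hl.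
    apply Cmod_gt_0. unfold squared_line. rewrite Cmod_square.
    apply Cmod_gt_0 in Hl. nra.
  - replace (Cmod (P - Q)) with (Cmod (Q - P) * (1 - 0))
      by (rewrite Cmod_sub_sym; ring).
    apply is_RInt_gen_eq_const; [lra|]. intros t Ht.
    apply speed_squared_line, segment_avoids_origin; assumption.
Qed.

Lemma kepler_plane_dist_square (P Q : C) :
  kepler_plane_dist (P ^ 2)%C (Q ^ 2)%C = Finite (cone_gap P Q).
Proof.
  apply Glb_Rbar_attained.
  - destruct (cone_gap_choose P Q) as [Q' [<- [-> Hle]]]. apply joined_segment, Hle.
  - intros L HL. apply (cone_gap_le_joined _ _ L HL); reflexivity.
Qed.

(** * The squaring map as an isometry *)

Lemma cone_point_surj (A : kepler_cone) : exists Q, A = cone_point Q.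
Proof.
  destruct A as [A [Q ->]]. exists Q. reflexivity.
Qed.

Lemma cone_point_square_eq (P Q : C) :
  (P ^ 2)%C = (Q ^ 2)%C -> cone_point P = cone_point Q.
Proof.
  intros H. destruct (C_square_eq P Q H) as [-> | ->]; [reflexivity|].
  assert (E : orbit (- Q) = orbit Q).
  { apply functional_extensionality. intros T. apply propositional_extensionality.
    unfold orbit. replace (- - Q)%C with Q by ring. tauto. }
  apply subset_eq_compat. exact E.
Qed.

Lemma squaring_isometry : exists f : kepler_cone -> C,
  (forall Q : C, f (cone_point Q) = (Q ^ 2)%C) /\
  isometry kepler_cone_dist kepler_plane_dist f.
Proof.
  destruct (functional_choice (fun A Q => A = cone_point Q) cone_point_surj) as [g Hg].
  assert (Hf : forall Q, (g (cone_point Q) ^ 2)%C = (Q ^ 2)%C).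
  { intros Q. pose proof (f_equal (@proj1_sig _ _) (Hg (cone_point Q))) as E.
    simpl in E.
    (* The chosen representative of the orbit of [Q] is [Q] or [- Q]. *)
    assert (H : orbit (g (cone_point Q)) Q) by (rewrite <- E; left; reflexivity).
    destruct H as [E' | E']; rewrite E' at 2; ring. }
  exists (fun A => (g A ^ 2)%C). split; [exact Hf|]. split; [|split].
  - intros A B. rewrite kepler_plane_dist_square, <- set_dist_orbit.
    unfold kepler_cone_dist.
    rewrite (f_equal (@proj1_sig _ _) (Hg A)), (f_equal (@proj1_sig _ _) (Hg B)).
    reflexivity.
  - intros A B H. rewrite (Hg A), (Hg B). apply cone_point_square_eq, H.
  - intros z. destruct (C_square_root z) as [Q HQ]. exists (cone_point Q).
    rewrite Hf. exact HQ.
Qed.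

Theorem proposition1 :
  (forall S : C -> Prop, kepler_parabola S ->
     geodesic_up_to_reparameterization ds1 punctured_plane S)
  /\
  (exists f : kepler_cone -> C,
     (forall Q : C, f (cone_point Q) = (Q ^ 2)%C) /\
     isometry kepler_cone_dist kepler_plane_dist f).
Proof. exact (conj kepler_parabola_geodesic squaring_isometry). Qed.
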